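(* Let $\{\lambda_k\}_{k\in\mathbb N}$ be a sequence of positive numbers, let $r=\{r_k\}\in\ell_2$ be a sequence of positive numbers, and let $\mathbb T=\{z\in\ell_2:\ |z_k|=r_k,\ k\in\mathbb N\}$. A trajectory, lying on $\mathbb T$, of the Hamiltonian system with Hamilton function $H(q,p)=\sum_{k=1}^{\infty}\frac{\lambda_k}{2}(p_k^2+q_k^2)$ is everywhere dense in $\mathbb T$ if and only if the family of numbers $\{\lambda_k,\ k\in\mathbb N\}$ is not rationally commensurable. (The equivalence is asserted for an arbitrary trajectory on $\mathbb T$.)
   Context: The phase space is the real Hilbert space $E=Q\oplus P$ with $Q=P=\ell_2(\mathbb N,\mathbb R)$, identified with the complex space $\ell_2=\ell_2(\mathbb N,\mathbb C)$ by $z_k=q_k+ip_k$. The flow of the Hamiltonian system with frequencies $\{\lambda_k\}$ is the group $\mathbf V_t$, $t\in\mathbb R$, given by $(\mathbf V_t z_0)_k=e^{i\lambda_k t}z_{0,k}$, $k\in\mathbb N$. The trajectory through $z_0$ is $\Gamma_{z_0}=\{\mathbf V_t z_0:\ t\in\mathbb R\}$. The torus $\mathbb T$ carries the topology induced by the norm of $E$. The family $\{\lambda_k\}_{k\in\mathbb N}$ is rationally commensurable if one of its members is a linear combination with rational coefficients of finitely many other members (members with different indices). Equivalently, it is not rationally commensurable iff for every $N\in\mathbb N$ and all $n_1,\dots,n_N\in\mathbb Z$, $\sum_{k=1}^N\lambda_k n_k=0$ implies $n_1=\dots=n_N=0$. *)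

(* Defs.v *)
From HB Require Import structures.
From mathcomp Require Import all_boot all_order all_algebra.
From mathcomp Require Import complex.
From mathcomp Require Import all_classical all_reals all_analysis.
From mathcomp Require Import ring lra.

Set Implicit Arguments.
Unset Strict Implicit.
Unset Printing Implicit Defensive.

Import Order.TTheory GRing.Theory Num.Theory Normc.
Import numFieldNormedType.Exports.

Local Open Scope classical_set_scope.
Local Open Scope ring_scope.
Local Open Scope complex_scope.

Section SquareSummable.
Context {R : realType}.
Implicit Types (u v : nat -> R) (x y z : nat -> R[i]).

Definition square_summable z : Prop :=
  cvgn (series (fun k => normc (z k) ^+ 2)).

Lemma normc_ge0 (c : R[i]) : 0 <= normc c.
Proof. by case: c => a b; exact: sqrtr_ge0. Qed.

Lemma normcZ (a : R) (c : R[i]) : normc (a%:C * c) = `|a| * normc c.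
Proof. by rewrite normcM /= expr0n /= addr0 sqrtr_sqr. Qed.

Let sq_ge0 z k : 0 <= normc (z k) ^+ 2.
Proof. exact: sqr_ge0. Qed.

Lemma square_summable0 : square_summable (fun=> 0).
Proof.
rewrite /square_summable (_ : series _ = cst 0); first exact: is_cvg_cst.
by apply/funext => n; rewrite /series /= big1// => i _; rewrite !expr0n addr0 sqrtr0 expr0n.
Qed.

Lemma square_summableZ (c : nat -> R[i]) (M : R) z :
  (forall k, normc (c k) <= M) -> square_summable z ->
  square_summable (fun k => c k * z k).
Proof.
move=> cM sz; apply: (@series_le_cvg _ _ (M ^+ 2 *: (fun k => normc (z k) ^+ 2))).
- by move=> k; exact: sqr_ge0.
- by move=> k; rewrite /= mulr_ge0// sqr_ge0.
- move=> k; rewrite normcM exprMn /= ler_wpM2r ?sqr_ge0//.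
  by rewrite lerXn2r ?nnegrE ?normc_ge0//; exact: le_trans (normc_ge0 (c k)) _.
- exact: is_cvg_seriesZ.
Qed.

(* Convexity of the square: the pointwise inequality that sums to Minkowski *)
Let sqrD_le (a b s t : R) : 0 < a -> 0 < b ->
  (s + t) ^+ 2 <= (1 + b / a) * s ^+ 2 + (1 + a / b) * t ^+ 2.
Proof.
move=> a0 b0; rewrite -subr_ge0.
rewrite (_ : _ - _ = (b * s - a * t) ^+ 2 / (a * b)).
  by rewrite divr_ge0 ?sqr_ge0// mulr_ge0// ltW.
by field; rewrite !gt_eqF.
Qed.

Let normcD_le (a b : R) x y k : 0 < a -> 0 < b ->
  normc (x k + y k) ^+ 2 <=
  (1 + b / a) * normc (x k) ^+ 2 + (1 + a / b) * normc (y k) ^+ 2.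
Proof.
move=> a0 b0; apply: le_trans (sqrD_le _ _ a0 b0).
by rewrite lerXn2r ?nnegrE ?addr_ge0 ?normc_ge0// le_normcD.
Qed.

Let cvg_bound (a b : R) x y : square_summable x -> square_summable y ->
  cvgn (series ((1 + b / a) *: (fun k => normc (x k) ^+ 2) +
                (1 + a / b) *: (fun k => normc (y k) ^+ 2))).
Proof. by move=> sx sy; apply: is_cvg_seriesD; exact: is_cvg_seriesZ. Qed.

Lemma square_summableD x y : square_summable x -> square_summable y ->
  square_summable (fun k => x k + y k).
Proof.
move=> sx sy; apply: series_le_cvg (@cvg_bound 1 1 _ _ sx sy).
- by move=> k; exact: sqr_ge0.
- by move=> k; rewrite addr_ge0// mulr_ge0// ?sqr_ge0// divr1 addr_ge0.
- by move=> k; exact: normcD_le.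
Qed.

Lemma square_summableN x : square_summable x -> square_summable (fun k => - x k).
Proof.
move=> sx; rewrite /square_summable (_ : (fun k => normc (- x k) ^+ 2) =
  (fun k => normc (x k) ^+ 2))//.
by apply/funext => k; rewrite normcN.
Qed.

Definition l2norm z : R := Num.sqrt (limn (series (fun k => normc (z k) ^+ 2))).

Lemma sqr_l2norm z : square_summable z ->
  l2norm z ^+ 2 = limn (series (fun k => normc (z k) ^+ 2)).
Proof.
move=> sz; rewrite sqr_sqrtr//; apply: limr_ge => //.
by apply: nearW => n; exact: sumr_ge0.
Qed.

Lemma normc_le_l2norm z k : square_summable z -> normc (z k) <= l2norm z.
Proof.
move=> sz; rewrite -(@ler_pXn2r _ 2)// ?nnegrE ?normc_ge0 ?sqrtr_ge0//.
rewrite sqr_l2norm//.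
apply: (@le_trans _ _ (series (fun k => normc (z k) ^+ 2) k.+1)).
  by rewrite /series /= big_nat_recr //= lerDr sumr_ge0.
apply: nondecreasing_cvgn_le => //.
by apply: nondecreasing_series => n _ _; exact: sq_ge0.
Qed.

Lemma l2norm_eq0 z : square_summable z -> l2norm z = 0 -> forall k, z k = 0.
Proof.
move=> sz z0 k; apply: eq0_normc; apply/eqP.
by rewrite eq_le normc_ge0 andbT -z0 normc_le_l2norm.
Qed.

Lemma l2normD x y : square_summable x -> square_summable y ->
  l2norm (fun k => x k + y k) <= l2norm x + l2norm y.
Proof.
move=> sx sy.
have [x0|x0] := eqVneq (l2norm x) 0.
  rewrite x0 add0r (_ : (fun k => _) = y)//.
  by apply/funext => k; rewrite (l2norm_eq0 sx x0) add0r.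
have [y0|y0] := eqVneq (l2norm y) 0.
  rewrite y0 addr0 (_ : (fun k => _) = x)//.
  by apply/funext => k; rewrite (l2norm_eq0 sy y0) addr0.
have {}x0 : 0 < l2norm x by rewrite lt_neqAle eq_sym x0 sqrtr_ge0.
have {}y0 : 0 < l2norm y by rewrite lt_neqAle eq_sym y0 sqrtr_ge0.
have sxy := square_summableD sx sy.
rewrite -(@ler_pXn2r _ 2)// ?nnegrE ?addr_ge0 ?sqrtr_ge0// sqr_l2norm//.
apply: (@le_trans _ _ (limn (series
    ((1 + l2norm y / l2norm x) *: (fun k => normc (x k) ^+ 2) +
     (1 + l2norm x / l2norm y) *: (fun k => normc (y k) ^+ 2))))).
  by apply: lim_series_le => // [|k]; [exact: cvg_bound|exact: normcD_le].
rewrite lim_seriesD; [|exact: is_cvg_seriesZ|exact: is_cvg_seriesZ].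
rewrite lim_seriesZ// lim_seriesZ// -!sqr_l2norm// /GRing.scale /=.
by rewrite le_eqVlt; apply/orP; left; apply/eqP; field; rewrite !gt_eqF.
Qed.

Lemma l2normZ (a : R) z : square_summable z ->
  l2norm (fun k => a%:C * z k) = `|a| * l2norm z.
Proof.
move=> sz; rewrite /l2norm -sqrtr_sqr -sqrtrM ?sqr_ge0//; congr Num.sqrt.
rewrite -[RHS]/(a ^+ 2 *: _) -lim_seriesZ//; congr (limn (series _)).
by apply/funext => k; rewrite normcZ exprMn real_normK ?num_real.
Qed.

End SquareSummable.

(* The boolean reflection only serves to make ell2 a subtype *)
Record ell2 (R : realType) := Ell2 {
  ell2_val :> nat -> R[i];
  ell2_subproof : `[< square_summable ell2_val >] }.

HB.instance Definition _ (R : realType) := [isSub for @ell2_val R].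
HB.instance Definition _ (R : realType) := [Choice of ell2 R by <:].

Section Ell2.
Context {R : realType}.
Implicit Types x y z : ell2 R.

Definition mk_ell2 (u : nat -> R[i]) (su : square_summable u) : ell2 R :=
  Ell2 (asboolT su).

Lemma ell2_summable z : square_summable z.
Proof. exact/asboolP/ell2_subproof. Qed.
Arguments ell2_summable z : clear implicits.

Lemma ell2P x y : (forall k, x k = y k) -> x = y.
Proof. by move=> xy; apply/val_inj/funext. Qed.

Definition ell2_zero := mk_ell2 (@square_summable0 R).
Definition ell2_add x y :=
  mk_ell2 (square_summableD (ell2_summable x) (ell2_summable y)).
Definition ell2_opp x := mk_ell2 (square_summableN (ell2_summable x)).
Definition ell2_scale (a : R) x : ell2 R :=
  mk_ell2 (@square_summableZ _ (fun=> a%:C) _ x (fun=> lexx _) (ell2_summable x)).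

Let addA : associative ell2_add.
Proof. by move=> x y z; apply: ell2P => k; exact: addrA. Qed.
Let addC : commutative ell2_add.
Proof. by move=> x y; apply: ell2P => k; exact: addrC. Qed.
Let add0 : left_id ell2_zero ell2_add.
Proof. by move=> x; apply: ell2P => k; exact: add0r. Qed.
Let addN : left_inverse ell2_zero ell2_opp ell2_add.
Proof. by move=> x; apply: ell2P => k; exact: addNr. Qed.

HB.instance Definition _ := GRing.isZmodule.Build (ell2 R) addA addC add0 addN.

Let scaleA a b x : ell2_scale a (ell2_scale b x) = ell2_scale (a * b) x.
Proof. by apply: ell2P => k; rewrite /= rmorphM mulrA. Qed.
Let scale1 : left_id 1 ell2_scale.
Proof. by move=> x; apply: ell2P => k; rewrite /= mul1r. Qed.
Let scaleDr : right_distributive ell2_scale +%R.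
Proof. by move=> a x y; apply: ell2P => k; rewrite /= mulrDr. Qed.
Let scaleDl x : {morph ell2_scale^~ x : a b / a + b}.
Proof. by move=> a b; apply: ell2P => k; rewrite /= rmorphD mulrDl. Qed.

HB.instance Definition _ :=
  GRing.Zmodule_isLmodule.Build R (ell2 R) scaleA scale1 scaleDr scaleDl.

Let normD x y : l2norm (x + y) <= l2norm x + l2norm y.
Proof. by apply: l2normD; exact: ell2_summable. Qed.
Let normZ (a : R) x : l2norm (a *: x) = `|a| * l2norm x.
Proof. by apply: l2normZ; exact: ell2_summable. Qed.
Let norm_eq0 x : l2norm x = 0 -> x = 0.
Proof. by move=> x0; apply: ell2P; apply: l2norm_eq0 x0; exact: ell2_summable. Qed.

HB.instance Definition _ :=
  Lmodule_isNormed.Build R (ell2 R) normD normZ norm_eq0.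

Lemma ell2_normE z : `|z| = Num.sqrt (limn (series (fun k => normc (z k) ^+ 2))).
Proof. by []. Qed.

End Ell2.
Arguments ell2_summable {R} z.

Section Flow.
Context {R : realType}.
Implicit Types (lambda r : nat -> R) (z : ell2 R) (t : R).

Definition expi (x : R) : R[i] := cos x +i* sin x.

Lemma normc_expi (x : R) : normc (expi x) = 1.
Proof. by rewrite /= cos2Dsin2 sqrtr1. Qed.

Let normc_expi_le lambda t k : normc (expi (lambda k * t)) <= 1.
Proof. by rewrite normc_expi. Qed.

Definition flow lambda t z : ell2 R :=
  mk_ell2 (square_summableZ (normc_expi_le lambda t) (ell2_summable z)).

Lemma flowE lambda t z k : flow lambda t z k = expi (lambda k * t) * z k.
Proof. by []. Qed.

Definition trajectory lambda z0 : set (ell2 R) :=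
  range (fun t => flow lambda t z0).

Definition torus r : set (ell2 R) := [set z | forall k, normc (z k) = r k].

Definition rationally_commensurable lambda : Prop :=
  exists k (s : seq nat) (c : nat -> rat),
    [/\ uniq s, k \notin s & lambda k = \sum_(j <- s) ratr (c j) * lambda j].

End Flow.

Section Hamilton.
Context {R : realType}.
Implicit Types (lambda : nat -> R) (z : ell2 R) (t : R).

Definition mode_energy lambda (z : nat -> R[i]) : nat -> R := fun k =>
  lambda k / 2 * (complex.Im (z k) ^+ 2 + complex.Re (z k) ^+ 2).

(* A convergent series only on [hamiltonian_dom], since lambda may be
   unbounded *)
Definition hamiltonian lambda z : R :=
  limn (series (mode_energy lambda z)).

Definition hamiltonian_dom lambda : set (ell2 R) :=
  [set z | cvgn (series (mode_energy lambda z))].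

Let bump (k : nat) (a : R) : nat -> R := fun j => if j == k then a else 0.

Let cvg_bump k a : series (bump k a) @ \oo --> a.
Proof.
apply: cvg_near_cst; exists k.+1 => // n /= kn.
rewrite /series /= (bigD1_seq k) ?iota_uniq ?mem_index_iota//= /bump eqxx.
by rewrite big1 ?addr0// => i /negbTE ->.
Qed.

Let square_summable_delta k (c : R[i]) :
  square_summable (fun j => if j == k then c else 0).
Proof.
rewrite /square_summable (_ : (fun j => _) = bump k (normc c ^+ 2)).
  by apply/cvg_ex; exists (normc c ^+ 2); exact: cvg_bump.
apply/funext => j; rewrite /bump; case: ifP => // _.
by rewrite /= !expr0n addr0 sqrtr0 expr0n.
Qed.

(* [ell2_delta k 1] and [ell2_delta k 'i] are the unit vectors along the
   coordinate axes q_k and p_k *)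
Definition ell2_delta k (c : R[i]) : ell2 R :=
  mk_ell2 (@square_summable_delta k c).

Let energyD lambda z k (c : R[i]) (h : R) :
  mode_energy lambda (h *: ell2_delta k c + z) =
  mode_energy lambda z + bump k (h * (lambda k *
      (complex.Re (z k) * complex.Re c + complex.Im (z k) * complex.Im c)) +
    h ^+ 2 * (lambda k / 2 * (complex.Re c ^+ 2 + complex.Im c ^+ 2))).
Proof.
apply/funext => j; rewrite /mode_energy /= /bump.
rewrite [X in _ = X]/GRing.add /=.
case: eqVneq => [->|_].
  by case: c (z k) => [a b] [x y] /=; field.
by case: (z j) => x y /=; field.
Qed.

Lemma is_derive_hamiltonian lambda z k (c : R[i]) : hamiltonian_dom lambda z ->
  is_derive z (ell2_delta k c) (hamiltonian lambda) (lambda k *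
    (complex.Re (z k) * complex.Re c + complex.Im (z k) * complex.Im c)).
Proof.
move=> Hz; set A := _ * _.
pose B := lambda k / 2 * (complex.Re c ^+ 2 + complex.Im c ^+ 2).
have HD (h : R) : hamiltonian lambda (h *: ell2_delta k c + z) =
    hamiltonian lambda z + (h * A + h ^+ 2 * B).
  rewrite -[LHS]/(limn (series (mode_energy lambda (h *: ell2_delta k c + z)))).
  rewrite energyD lim_seriesD//; last first.
    by apply/cvg_ex; eexists; exact: cvg_bump.
  by congr (_ + _); exact/cvg_lim/cvg_bump.
have lim : h^-1 *: (hamiltonian lambda (h *: ell2_delta k c + z) -
    hamiltonian lambda z) @[h --> 0^'] --> A.
  have : A + h * B @[h --> (0 : R)^'] --> A.
    rewrite -[X in _ --> X]addr0 -[X in _ --> _ + X](mul0r B).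
    apply: cvgD; first exact: cvg_cst.
    apply: cvgMr_tmp; exact: nbhs_dnbhs.
  apply: cvg_trans; apply: near_eq_cvg; near=> h.
  have h0 : h != 0 by near: h; exact: nbhs_dnbhs_neq.
  by rewrite HD /GRing.scale /=; field.
apply: DeriveDef; first by apply/cvg_ex; exists A.
exact: cvg_lim.
Unshelve. all: by end_near. Qed.

Lemma flow_hamiltonian_dom lambda t z :
  hamiltonian_dom lambda z -> hamiltonian_dom lambda (flow lambda t z).
Proof.
rewrite /hamiltonian_dom /=.
suff -> : mode_energy lambda (flow lambda t z) = mode_energy lambda z by [].
apply/esym/funext => k; congr (_ * _); rewrite flowE.
have := cos2Dsin2 (lambda k * t).
rewrite /expi; case: (z k) => x y /=; move: (cos _) (sin _) => C S CS.
rewrite -[LHS]mul1r -CS; ring.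
Qed.

(* Hamilton's equations with the symplectic sign for which the flow is
   exp (i lambda t) rather than exp (- i lambda t): q' = - dH/dp, p' = dH/dq,
   where z_k = q_k + i p_k *)
Lemma flow_hamilton lambda t z k : hamiltonian_dom lambda z ->
  is_derive t 1 (fun s => complex.Re (flow lambda s z k))
    (- 'D_(ell2_delta k 'i) (hamiltonian lambda) (flow lambda t z)) /\
  is_derive t 1 (fun s => complex.Im (flow lambda s z k))
    ('D_(ell2_delta k 1) (hamiltonian lambda) (flow lambda t z)).
Proof.
move=> /(@flow_hamiltonian_dom _ t) Hz.
have [_ ->] := @is_derive_hamiltonian _ _ k 'i Hz.
have [_ ->] := @is_derive_hamiltonian _ _ k 1 Hz.
have lt : is_derive t (1 : R) (fun s => lambda k * s) (lambda k).
  by apply: is_derive_eq; rewrite /GRing.scale /= mulr1.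
have ReE s : complex.Re (flow lambda s z k) =
    cos (lambda k * s) * complex.Re (z k) - sin (lambda k * s) * complex.Im (z k).
  by rewrite flowE /expi; case: (z k).
have ImE s : complex.Im (flow lambda s z k) =
    cos (lambda k * s) * complex.Im (z k) + sin (lambda k * s) * complex.Re (z k).
  by rewrite flowE /expi; case: (z k).
rewrite (funext ReE) (funext ImE) ReE ImE.
by split; apply: is_derive_eq; rewrite /GRing.scale /=; ring.
Qed.

End Hamilton.

(* Main.v *)
(* Density follows from Kronecker's theorem. Write G_m = m F_m, with F_m the
   Fejer kernel: G_m >= 0 and (1 - cos x) G_m(x) = 1 - cos (m x) have constant
   coefficients m and 1. For rationally independent frequencies the time average
   of a product of cosine polynomials in the angles lambda_k t - a_k is the
   product of their constant coefficients. Hence the average of 1 - cos theta_i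
   weighted by \prod_k G_m(theta_k) is 1 / m, so that the first N angles are
   simultaneously close to 0 at some time; the remaining modes are controlled
   by the tail of \sum_k r_k ^ 2. Conversely, an integer relation between the
   frequencies fixes a monomial in the phases along the trajectory. *)

Require Import Defs.
From mathcomp Require Import all_boot all_order all_algebra.
From mathcomp Require Import complex.
From mathcomp Require Import all_classical all_reals all_analysis.
From mathcomp Require Import ring lra.

Import Order.TTheory GRing.Theory Num.Theory Normc.
Import numFieldNormedType.Exports.

Local Open Scope classical_set_scope.
Local Open Scope ring_scope.

(** * Time averages, encoded by bounded primitives *)

Section Mean.
Context {R : realType}.
Implicit Types (f g p : R -> R) (b c x t : R).

(* [g] being bounded, (1 / T) \int_0^T f --> c as T --> +oo. *)
Definition has_mean f c : Prop :=
  exists g, (exists M, forall t, `|g t| <= M) /\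
    forall t, is_derive t (1 : R) g (f t - c).

Lemma has_mean_ext f1 f2 c : f1 =1 f2 -> has_mean f1 c -> has_mean f2 c.
Proof. by move=> /funext->. Qed.

Lemma has_mean_cst c : has_mean (fun=> c) c.
Proof.
exists (cst 0); split; first by exists 0 => t; rewrite normr0.
by move=> t; rewrite subrr; exact: is_derive_cst.
Qed.

Lemma has_meanD f1 f2 c1 c2 : has_mean f1 c1 -> has_mean f2 c2 ->
  has_mean (fun t => f1 t + f2 t) (c1 + c2).
Proof.
move=> [g1 [[M1 gM1] dg1]] [g2 [[M2 gM2] dg2]]; exists (g1 + g2); split.
  by exists (M1 + M2) => t; apply: le_trans (ler_normD _ _) (lerD _ _).
move=> t; have := is_deriveD (dg1 t) (dg2 t).
by rewrite addrACA -opprD.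
Qed.

Lemma has_meanZ b f c : has_mean f c -> has_mean (fun t => b * f t) (b * c).
Proof.
move=> [g [[M gM] dg]]; exists (b *: g); split.
  by exists (`|b| * M) => t; rewrite normrM ler_wpM2l.
by move=> t; have := is_deriveZ b (dg t); rewrite [_ *: (_ - _)]mulrBr.
Qed.

Lemma has_mean_sum (I : Type) (s : seq I) (f : I -> R -> R) (c : I -> R) :
  (forall i, has_mean (f i) (c i)) ->
  has_mean (fun t => \sum_(i <- s) f i t) (\sum_(i <- s) c i).
Proof.
move=> fc; elim: s => [|i s IH].
  rewrite big_nil; apply: has_mean_ext (has_mean_cst 0) => t.
  by rewrite big_nil.
rewrite big_cons; apply: has_mean_ext (has_meanD _ _ _ _ (fc i) IH) => t.
by rewrite big_cons.
Qed.

Lemma has_mean_cos b a : b != 0 -> has_mean (fun t => cos (b * t + a)) 0.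
Proof.
move=> b0; exists (fun t => b^-1 * sin (b * t + a)); split.
  exists `|b^-1| => t; rewrite normrM ler_piMr// ler_norml.
  by rewrite sin_geN1 sin_le1.
move=> t; have db : is_derive t (1 : R) (fun t => b * t + a) b.
  by apply: is_derive_eq; rewrite /GRing.scale /= mulr1 addr0.
apply: is_derive_eq; rewrite /GRing.scale /= subr0.
by field.
Qed.

(* The mean value theorem on [0, T] gives g T - g 0 >= - c T, which for c < 0
   contradicts the boundedness of g when T is large. *)
Lemma has_mean_ge0 f c : has_mean f c -> (forall t, 0 <= f t) -> 0 <= c.
Proof.
move=> [g [[M gM] dg]] f0; rewrite leNgt; apply/negP => c0.
have M0 : 0 <= M by exact: le_trans (normr_ge0 _) (gM 0).
(* This makes [- c * T] equal to [2 * M + 1], more than [g], bounded by [M], can vary. *)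
pose T := (2 * M + 1) / - c.
have T0 : 0 < T by rewrite divr_gt0 ?oppr_gt0// ltr_wpDl// mulr_ge0.
have [x _ gT] : exists2 x, x \in `]0, T[ & g T - g 0 = (f x - c) * (T - 0).
  apply: MVT => //.
  by apply: derivable_within_continuous => x _; case: (dg x).
have : 2 * M + 1 <= g T - g 0.
  rewrite gT subr0 (_ : 2 * M + 1 = - c * T); last first.
    by rewrite /T; field; rewrite lt_eqF.
  by rewrite ler_wpM2r ?(ltW T0)// lerDr.
have := gM T; have := gM 0; rewrite !ler_norml => /andP[+ _] /andP[_ +].
lra.
Qed.

End Mean.

(** * Cosine polynomials and the Fejer kernel *)

Section Kronecker.
Context {R : realType}.
Implicit Types (p : R -> R) (b c x t : R) (m N : nat).

(* [c] is the constant coefficient *)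
Inductive cosine_poly : (R -> R) -> R -> Prop :=
| cosine_poly_cst c : cosine_poly (fun=> c) c
| cosine_poly_cos j : cosine_poly (fun x => cos (j.+1%:R * x)) 0
| cosine_polyD p1 p2 c1 c2 : cosine_poly p1 c1 -> cosine_poly p2 c2 ->
    cosine_poly (fun x => p1 x + p2 x) (c1 + c2)
| cosine_polyZ b p c : cosine_poly p c ->
    cosine_poly (fun x => b * p x) (b * c).

Lemma cosine_poly_sum (I : Type) (s : seq I) (p : I -> R -> R) (c : I -> R) :
  (forall i, cosine_poly (p i) (c i)) ->
  cosine_poly (fun t => \sum_(i <- s) p i t) (\sum_(i <- s) c i).
Proof.
move=> pc; elim: s => [|i s IH].
  rewrite big_nil (_ : (fun _ => _) = fun=> 0); first exact: cosine_poly_cst.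
  by apply/funext => t; rewrite big_nil.
rewrite big_cons (_ : (fun _ => _) = fun t => p i t + \sum_(i <- s) p i t).
  exact: cosine_polyD.
by apply/funext => t; rewrite big_cons.
Qed.

Definition dirichlet m x : R := 1 + \sum_(j < m) 2 * cos (j.+1%:R * x).

Lemma cosine_poly_dirichlet m : cosine_poly (dirichlet m) 1.
Proof.
rewrite -[1]addr0; apply: cosine_polyD; first exact: cosine_poly_cst.
rewrite [X in cosine_poly _ X](_ : _ = \sum_(j < m) 0); last by rewrite big1.
apply: cosine_poly_sum => j; rewrite -(mulr0 2); apply: cosine_polyZ.
exact: cosine_poly_cos.
Qed.

(** By product-to-sum, [(1 - cos x) * 2 * cos (k x)] is minus the second difference of [cos (k x)]
    in [k], so the sum telescopes. *)
Lemma dirichletE m x :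
  (1 - cos x) * dirichlet m x = cos (m%:R * x) - cos (m.+1%:R * x).
Proof.
elim: m => [|m IH]; first by rewrite /dirichlet big_ord0 addr0 mul0r cos0 mul1r mulr1.
rewrite /dirichlet big_ord_recr /= addrA mulrDr -/(dirichlet m x) IH.
have -> : m%:R * x = m.+1%:R * x - x by rewrite -natr1; ring.
have -> : m.+2%:R * x = m.+1%:R * x + x by rewrite -(natr1 m.+1); ring.
by rewrite cosB cosD; ring.
Qed.

(* m times the usual Fejer kernel *)
Definition fejer m x : R := \sum_(i < m) dirichlet i x.

Lemma cosine_poly_fejer m : cosine_poly (fejer m) m%:R.
Proof.
rewrite -[m in m%:R]card_ord -sum1_card natr_sum.
by apply: cosine_poly_sum => i; exact: cosine_poly_dirichlet.
Qed.

Lemma fejerE m x : (1 - cos x) * fejer m x = 1 - cos (m%:R * x).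
Proof.
elim: m => [|m IH]; first by rewrite /fejer big_ord0 mul0r cos0 mulr0 subrr.
by rewrite /fejer big_ord_recr /= mulrDr IH dirichletE addrA subrK.
Qed.

Lemma cos1_nat m x : cos x = 1 -> cos (m%:R * x) = 1.
Proof.
move=> x1; have s0 : sin x = 0.
  by apply/eqP; rewrite -sqrf_eq0 sin2cos2 x1 expr1n subrr.
elim: m => [|m IH]; first by rewrite mul0r cos0.
by rewrite -natr1 mulrDl mul1r cosD IH x1 s0 mulr0 mulr1 subr0.
Qed.

Lemma fejer_ge0 m x : 0 <= fejer m x.
Proof.
(* Where [cos x = 1], [fejerE] reads [0 = 0]; there every cosine in the kernel is 1. *)
have [x1|x1] := eqVneq (cos x) 1.
  apply: sumr_ge0 => i _; rewrite addr_ge0// sumr_ge0// => j _.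
  by rewrite cos1_nat// mulr1.
have x0 : 0 < 1 - cos x by rewrite subr_gt0 lt_neqAle x1 cos_le1.
by rewrite -(pmulr_rge0 _ x0) fejerE subr_ge0 cos_le1.
Qed.

(** * Means of products over independent frequencies, and Kronecker's theorem *)

(** The factor [cos (b t + d)] carries the induction on [N]: product-to-sum merges it with a cosine
    of the last factor, which shifts [b] by an integer multiple of [lambda N] and so keeps it
    outside the integer span of the remaining frequencies. *)
Lemma mean_cos_prod (lambda a : nat -> R) (p : nat -> R -> R) (c : nat -> R) N :
  (forall k, cosine_poly (p k) (c k)) ->
  forall b d, (forall n : nat -> int, b + \sum_(k < N) (n k)%:~R * lambda k != 0) ->
  has_mean (fun t => cos (b * t + d) * \prod_(k < N) p k (lambda k * t - a k)) 0.
Proof.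
move=> pc; elim: N => [|N IH] b d bN.
  have b0 : b != 0 by have := bN (fun=> 0); rewrite big_ord0 addr0.
  apply: has_mean_ext (has_mean_cos b d b0) => t.
  by rewrite big_ord0 mulr1.
pose P t := \prod_(k < N) p k (lambda k * t - a k).
suff : has_mean (fun t => cos (b * t + d) * p N (lambda N * t - a N) * P t) 0.
  by apply: has_mean_ext => t; rewrite big_ord_recr /= mulrAC mulrA.
(* The mean is linear in the last factor, so it suffices to follow its construction as a cosine
   polynomial. *)
elim: (pc N) => {pc c} [c|j|p1 p2 c1 c2 _ IH1 _ IH2|e q c _ IHq].
- rewrite -(mulr0 c); apply: has_mean_ext (has_meanZ c _ _ (IH b d _)) => [t|n].
    by rewrite /P; ring.
  have := bN (fun k => if (k < N)%N then n k else 0).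
  rewrite big_ord_recr /= ltnn mul0r addr0.
  by under eq_bigr do rewrite ltn_ord.
- have shift (e : int) (n : nat -> int) : b + e%:~R * lambda N + \sum_(k < N) (n k)%:~R * lambda k != 0.
    have := bN (fun k => if (k < N)%N then n k else e).
    rewrite big_ord_recr /= ltnn addrAC addrA.
    by under eq_bigr do rewrite ltn_ord.
  have := has_meanD _ _ _ _
    (has_meanZ 2^-1 _ _ (IH _ (d - j.+1%:R * a N) (shift j.+1%:Z)))
    (has_meanZ 2^-1 _ _ (IH _ (d + j.+1%:R * a N) (shift (- j.+1%:Z)))).
  rewrite mulr0 addr0; apply: has_mean_ext => t; rewrite -/(P t).
  set u := b * t + d; set v := j.+1%:R * (lambda N * t - a N).
  rewrite (_ : _ + (d - _) = u + v); last by rewrite /u /v -pmulrn; ring.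
  rewrite (_ : _ + (d + _) = u - v); last by rewrite /u /v mulrNz -pmulrn; ring.
  by rewrite cosD cosB; field.
- have := has_meanD _ _ _ _ IH1 IH2; rewrite addr0.
  by apply: has_mean_ext => t; ring.
- have := has_meanZ e _ _ IHq; rewrite mulr0.
  by apply: has_mean_ext => t; ring.
Qed.

(** Division by [j.+1] would turn a vanishing combination into a rational expression of [lambda N]
    through frequencies of smaller index. *)
Lemma incommensurable_span (lambda : nat -> R) N j (n : nat -> int) :
  ~ rationally_commensurable lambda ->
  j.+1%:R * lambda N + \sum_(k < N) (n k)%:~R * lambda k != 0.
Proof.
move=> lam; apply/eqP => e; apply: lam.
exists N, (iota 0 N), (fun k => - (n k)%:~R / j.+1%:R); split.
- exact: iota_uniq.
- by rewrite mem_iota ltnn andbF.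
- have j0 : j.+1%:R != 0 :> R by rewrite pnatr_eq0.
  apply: (mulfI j0); move/eqP: e; rewrite addr_eq0 => /eqP->.
  rewrite -sumrN mulr_sumr -[N in iota 0 N]subn0 big_mkord.
  apply: eq_bigr => k _.
  by rewrite fmorph_div rmorphN /= ratr_int ratr_nat mulrA [_ * (_ / _)]mulrC divfK// mulNr.
Qed.

(** When the last factor is split off, its constant part multiplies the mean, while each of its
    cosines has a frequency outside the integer span of the earlier ones and contributes 0 by
    [mean_cos_prod]. *)
Lemma mean_prod (lambda a : nat -> R) (p : nat -> R -> R) (c : nat -> R) N :
  ~ rationally_commensurable lambda ->
  (forall k, cosine_poly (p k) (c k)) ->
  has_mean (fun t => \prod_(k < N) p k (lambda k * t - a k)) (\prod_(k < N) c k).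
Proof.
move=> lam pc; elim: N => [|N IH].
  rewrite big_ord0; apply: has_mean_ext (has_mean_cst 1) => t.
  by rewrite big_ord0.
pose P t := \prod_(k < N) p k (lambda k * t - a k).
suff : has_mean (fun t => p N (lambda N * t - a N) * P t) (c N * \prod_(k < N) c k).
  rewrite big_ord_recr /= mulrC.
  by apply: has_mean_ext => t; rewrite big_ord_recr /= mulrC.
elim: (pc N) => [e|j|p1 p2 c1 c2 _ IH1 _ IH2|e q d _ IHq].
- exact: has_meanZ.
- rewrite mul0r.
  have := mean_cos_prod lambda a p c N pc (j.+1%:R * lambda N) (- (j.+1%:R * a N)).
  move=> /(_ (fun n => incommensurable_span _ _ _ n lam)).
  by apply: has_mean_ext => t; rewrite mulrBr mulrA.
- by rewrite mulrDl; apply: has_mean_ext (has_meanD _ _ _ _ IH1 IH2) => t; rewrite mulrDl.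
- by rewrite -mulrA; apply: has_mean_ext (has_meanZ e _ _ IHq) => t; rewrite mulrA.
Qed.

(* Otherwise [\sum_i (1 - cos theta_i) >= e] at every time [t]; integrating
   this against the product of the Fejer kernels yields [N >= e m]. *)
Lemma kronecker (lambda a : nat -> R) N (e : R) :
  ~ rationally_commensurable lambda -> 0 < e ->
  exists t, forall k, (k < N)%N -> 1 - cos (lambda k * t - a k) < e.
Proof.
move=> lam e0; apply: contrapT => noT.
have sumN t : e <= \sum_(i < N) (1 - cos (lambda i * t - a i)).
  rewrite leNgt; apply/negP => lte; apply: noT; exists t => k kN.
  apply: le_lt_trans lte; rewrite (bigD1 (Ordinal kN)) //= lerDl.
  by apply: sumr_ge0 => i _; rewrite subr_ge0 cos_le1.
(* Large enough for [N < e * m], against the averaged inequality. *)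
pose m := (Num.truncn (N%:R / e)).+1.
have m0 : 0 < m%:R :> R by rewrite ltr0n.
have Nm : N%:R < e * m%:R.
  by rewrite mulrC -ltr_pdivrMr// truncnS_gt.
pose F t := \prod_(k < N) fejer m (lambda k * t - a k).
have mF : has_mean F (m%:R ^+ N).
  have := mean_prod lambda a (fun=> fejer m) (fun=> m%:R) N lam
    (fun=> cosine_poly_fejer m).
  by rewrite prodr_const card_ord.
have cp1 : cosine_poly (fun x => 1 - cos (m%:R * x)) 1.
  rewrite (_ : (fun _ => _) = fun x => 1 + -1 * cos (m%:R * x)).
    rewrite -[X in cosine_poly _ X]addr0 -(mulr0 (-1)).
    apply: cosine_polyD; first exact: cosine_poly_cst.
    exact/cosine_polyZ/cosine_poly_cos.
  by apply/funext => x; rewrite mulN1r.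
have mi (i : 'I_N) : has_mean (fun t => (1 - cos (lambda i * t - a i)) * F t) (m%:R ^+ N.-1).
  (* By [fejerE] the factor [1 - cos] turns the [i]-th kernel into [1 - cos (m x)], whose constant
     coefficient is 1 instead of [m]. *)
  pose p k := if k == i :> nat then fun x => 1 - cos (m%:R * x) else fejer m.
  pose c k : R := if k == i :> nat then 1 else m%:R.
  have pc k : cosine_poly (p k) (c k).
    by rewrite /p /c; case: ifP => // _; exact: cosine_poly_fejer.
  have := mean_prod lambda a p c N lam pc.
  rewrite (bigD1 i)//= {1}/c eqxx mul1r.
  rewrite (eq_bigr (fun=> m%:R)); last first.
    by move=> k; rewrite -val_eqE /c => /negbTE->.
  rewrite prodr_const -[X in _ ^+ X]/#|predC1 i| cardC1 card_ord.
  apply: has_mean_ext => t; rewrite (bigD1 i)//= {1}/p eqxx -fejerE -mulrA.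
  rewrite /F [in RHS](bigD1 i)//=; congr (_ * (_ * _)).
  by apply: eq_bigr => k; rewrite -val_eqE /p => /negbTE->.
have := has_meanD _ _ _ _ (has_mean_sum _ (index_enum 'I_N) _ _ mi)
  (has_meanZ (- e) _ _ mF).
move=> /has_mean_ge0; rewrite sumr_const card_ord => meanN.
have {meanN} : 0 <= m%:R ^+ N.-1 *+ N + - e * m%:R ^+ N.
  apply: meanN => t; rewrite -mulr_suml -mulrDl mulr_ge0//.
    by rewrite subr_ge0.
  by apply: prodr_ge0 => k _; exact: fejer_ge0.
(* Makes [N.-1] a true predecessor: for [N = 0] the empty sum contradicts [sumN]. *)
have N0 : (0 < N)%N.
  rewrite lt0n; apply/eqP => N0; have := sumN 0.
  by rewrite big_pred0 ?leNgt ?e0// => -[i iN]; move: (iN); rewrite N0.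
have -> : m%:R ^+ N = m%:R * m%:R ^+ N.-1 :> R by rewrite -exprS prednK.
rewrite mulrA mulNr -mulr_natl -mulrDl pmulr_lge0 ?exprn_gt0//.
by rewrite subr_ge0 leNgt Nm.
Qed.

End Kronecker.

(** * Phases on the torus, and density for incommensurable frequencies *)

Section Torus.
Context {R : realType}.
Implicit Types (lambda r : nat -> R) (x y t : R) (c : R[i]) (z w : ell2 R).

Lemma expiD x y : expi (x + y) = expi x * expi y.
Proof. by rewrite /expi cosD sinD; congr Complex; rewrite addrC. Qed.

Lemma expi0 : expi (0 : R) = 1.
Proof. by rewrite /expi cos0 sin0. Qed.

Lemma sqr_normc_expiB x y :
  normc (expi x - expi y) ^+ 2 = 2 * (1 - cos (x - y)).
Proof.
rewrite /= sqr_sqrtr ?addr_ge0 ?sqr_ge0// cosB.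
have := cos2Dsin2 x; have := cos2Dsin2 y.
move: (cos x) (cos y) (sin x) (sin y) => a b c d H K.
lra.
Qed.

Lemma normc1_expi c : normc c = 1 -> exists x, c = expi x.
Proof.
case: c => a b /= ab1.
have {}ab1 : a ^+ 2 + b ^+ 2 = 1.
  by rewrite -[LHS]sqr_sqrtr ?addr_ge0 ?sqr_ge0// ab1 expr1n.
have a1 : -1 <= a <= 1.
  rewrite -ler_norml -(@expr_le1 _ 2)// real_normK ?num_real// -ab1.
  by rewrite lerDl sqr_ge0.
have sa : sin (acos a) = `|b|.
  by rewrite sin_acos// -ab1 addrAC subrr add0r sqrtr_sqr.
have [_ ca] := acos_def a1.
(* [acos a] has sine [|b|], so the sign of [b] selects this angle or its opposite. *)
have [b0|b0] := leP 0 b.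
  by exists (acos a); rewrite /expi ca sa ger0_norm.
by exists (- acos a); rewrite /expi cosN sinN ca sa ltr0_norm// opprK.
Qed.

Lemma trajectory_torus lambda r z : trajectory lambda z `<=` torus r ->
  torus r z.
Proof.
move=> zr k; have /= <- : torus r (flow lambda 0 z) by apply: zr; exists 0.
by rewrite normcM normc_expi mul1r.
Qed.

Lemma torus_angle r z w : (forall k, 0 < r k) -> torus r z -> torus r w ->
  exists a : nat -> R, forall k, w k = expi (a k) * z k.
Proof.
move=> r0 zr wr; suff /choice[a aP] : forall k, exists x, w k = expi x * z k by exists a.
move=> k.
have zk0 : z k != 0.
  apply/eqP => zk0; have := r0 k.
  by rewrite -(zr k) zk0 normc0 ltxx.
have [|x wx] := @normc1_expi (w k / z k).
  by rewrite normcM normcV zr wr divff// gt_eqF.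
by exists x; rewrite -wx divfK.
Qed.

Lemma trajectory_dense lambda r z : (forall k, 0 < r k) ->
  cvgn (series (fun k => r k ^+ 2)) -> torus r z ->
  ~ rationally_commensurable lambda ->
  torus r `<=` closure (trajectory lambda z).
Proof.
move=> r0 r2 zr lam w wr.
have [a wE] := torus_angle _ _ _ r0 zr wr.
suff near_w e : 0 < e -> exists t, `|w - flow lambda t z| < e.
  move=> B /nbhs_ballP[e /= e0 eB]; have [t te] := near_w _ e0.
  exists (flow lambda t z); split; first by exists t.
  by apply: eB; rewrite -ball_normE.
move=> e0; set S := limn (series (fun k => r k ^+ 2)).
have e20 : 0 < e ^+ 2 by rewrite exprn_gt0.
have partial_le n : series (fun k => r k ^+ 2) n <= S.
  apply: nondecreasing_cvgn_le => //.
  by apply: nondecreasing_series => k _ _; exact: sqr_ge0.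
have S0 : 0 <= S.
  by apply: le_trans (partial_le 0%N); rewrite /series /= big_nil.
(* Since [1 - cos] is at most 2, the squared error in mode [k] is at most [4 * r k ^+ 2]; a tail of
   [e ^+ 2 / 16] thus costs [e ^+ 2 / 4]. *)
have [N _ tailN] : \forall n \near \oo,
    S - e ^+ 2 / 16 < series (fun k => r k ^+ 2) n.
  by apply: cvgr_gt r2 _ _; rewrite ltrBlDr ltrDl divr_gt0.
(* With the factor 2 of the chord formula and partial sums at most [S], this precision makes the
   first [N] modes cost at most [e ^+ 2 / 4]. *)
have d0 : 0 < e ^+ 2 / (8 * (S + 1)).
  by rewrite divr_gt0// mulr_gt0// ltr_wpDl.
have [t ht] := kronecker lambda a N _ lam d0.
exists t; set v := w - flow lambda t z.
have vE k : normc (v k) ^+ 2 = 2 * (1 - cos (lambda k * t - a k)) * r k ^+ 2.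
  rewrite -[v k]/(w k - flow lambda t z k) wE flowE -mulrBl normcM exprMn zr.
  by rewrite sqr_normc_expiB -cosN opprB.
rewrite -(@ltr_pXn2r _ 2)// ?nnegrE ?normr_ge0 ?(ltW e0)//.
rewrite [X in X ^+ 2 < _]/(l2norm v) sqr_l2norm; last exact: ell2_summable.
(* Limits preserve only weak inequalities, hence the margin; head and tail get half of this bound
   each. *)
apply: (@le_lt_trans _ _ (e ^+ 2 / 2)); last by lra.
apply: limr_le; first exact: (ell2_summable v).
near=> n; have Nn : (N <= n)%N by near: n; exact: nbhs_infty_ge.
rewrite (_ : series _ n = series (fun k => normc (v k) ^+ 2) N +
  \sum_(N <= k < n) normc (v k) ^+ 2); last first.
  by rewrite -sub_series_geq// addrC subrK.
have headle : series (fun k => normc (v k) ^+ 2) N <= e ^+ 2 / 4.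
  apply: (@le_trans _ _ (e ^+ 2 / (4 * (S + 1)) * S)); last first.
    rewrite invfM mulrA -mulrA ler_piMr ?divr_ge0 ?(ltW e20)//.
    by rewrite mulrC ler_pdivrMr ?ltr_wpDl// mul1r lerDl.
  apply: (@le_trans _ _ (e ^+ 2 / (4 * (S + 1)) * series (fun k => r k ^+ 2) N)).
    rewrite /series /= mulr_sumr; apply: ler_sum_nat => k /andP[_ kN].
    rewrite vE ler_wpM2r ?sqr_ge0//.
    rewrite (_ : _ / _ = 2 * (e ^+ 2 / (8 * (S + 1)))).
      by rewrite ler_wpM2l// ltW// ht.
    by field; rewrite gt_eqF// ltr_wpDl.
  by rewrite ler_wpM2l// divr_ge0 ?(ltW e20)// mulr_ge0// addr_ge0.
have taille : \sum_(N <= k < n) normc (v k) ^+ 2 <=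
    4 * (series (fun k => r k ^+ 2) n - series (fun k => r k ^+ 2) N).
  rewrite sub_series_geq// mulr_sumr; apply: ler_sum => k _.
  rewrite vE ler_wpM2r ?sqr_ge0//.
  by have := cos_geN1 (lambda k * t - a k); lra.
have /= := tailN N (leqnn N); have := partial_le n.
lra.
Unshelve. all: by end_near. Qed.

End Torus.

(** * Rational relations obstruct density *)

Section DenseIncommensurable.
Context {R : realType}.
Implicit Types (lambda r : nat -> R) (x y t : R) (z w : ell2 R).

Lemma normc_expiN x : normc (expi (- x) - 1) = normc (expi x - 1).
Proof. by rewrite /= cosN sinN !oppr0 !addr0 sqrrN. Qed.

(** Multiplication by [expi x] is an isometry, so the triangle inequality applies; iteration
    controls integer combinations of angles. *)
Lemma normc_expiD_le x y :
  normc (expi (x + y) - 1) <= normc (expi x - 1) + normc (expi y - 1).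
Proof.
rewrite expiD (_ : _ - 1 = expi x * (expi y - 1) + (expi x - 1)); last by ring.
apply: le_trans (le_normcD _ _) _.
by rewrite normcM normc_expi mul1r addrC.
Qed.

Lemma normc_expi_intM (n : int) x :
  normc (expi (n%:~R * x) - 1) <= `|n|%:~R * normc (expi x - 1).
Proof.
have natM m : normc (expi (m%:R * x) - 1) <= m%:R * normc (expi x - 1).
  elim: m => [|m IH]; first by rewrite !mul0r expi0 subrr normc0.
  rewrite -natr1 !mulrDl !mul1r; apply: le_trans (normc_expiD_le _ _) _.
  by rewrite lerD2r.
case: n => m; first exact: natM.
by rewrite NegzE normrN mulrNz mulNr normc_expiN -pmulrn; exact: natM.
Qed.

Lemma normc_expi_sum (s : seq nat) (n : nat -> int) (x : nat -> R) :
  normc (expi (\sum_(j <- s) (n j)%:~R * x j) - 1) <=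
  \sum_(j <- s) `|n j|%:~R * normc (expi (x j) - 1).
Proof.
elim: s => [|j s IH]; first by rewrite !big_nil expi0 subrr normc0.
rewrite !big_cons; apply: le_trans (normc_expiD_le _ _) (lerD _ IH).
exact: normc_expi_intM.
Qed.

Lemma common_denominator (s : seq nat) (c : nat -> rat) :
  exists2 D : nat, (0 < D)%N & forall j, j \in s -> D%:R * c j \is a Num.int.
Proof.
elim: s => [|i s [D D0 Ds]]; first by exists 1%N.
have [m dm] : exists m : nat, denq (c i) = m%:Z.
  by exists `|denq (c i)|%N; rewrite gez0_abs// ltW.
have m0 : (0 < m)%N by rewrite -ltz_nat -dm.
exists (D * m)%N; first by rewrite muln_gt0 D0.
move=> j; rewrite inE natrM => /predU1P[->|/Ds js].
  by rewrite -mulrA [_ * c i]mulrC [m%:R]pmulrn -dm -numqE rpredM ?natr_int ?intr_int.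
by rewrite mulrAC rpredM ?natr_int.
Qed.

Lemma integer_relation lambda : rationally_commensurable lambda ->
  exists (k : nat) (s : seq nat) (n : nat -> int) (D : nat),
    [/\ k \notin s, (0 < D)%N &
        D%:R * lambda k = \sum_(j <- s) (n j)%:~R * lambda j].
Proof.
move=> [k [s [c [_ ks lamk]]]]; have [D D0 Ds] := common_denominator s c.
exists k, s, (fun j => numq (D%:R * c j)), D; split => //.
rewrite lamk mulr_sumr; apply: eq_big_seq => j /Ds /numqK H.
by rewrite mulrA -[in RHS]ratr_int H rmorphM /= ratr_nat.
Qed.

(* Rotating only the [k]-th coordinate of [z] by [pi / D] leaves the closure
   of the trajectory: on the latter the phase of
   [z_k ^ D / \prod_j z_j ^ n_j] is constant. *)
Lemma dense_incommensurable lambda r z : (forall k, 0 < r k) -> torus r z ->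
  torus r `<=` closure (trajectory lambda z) ->
  ~ rationally_commensurable lambda.
Proof.
move=> r0 zr dense /integer_relation[k [s [n [D [ks D0 rel]]]]].
pose a j : R := if j == k then pi / D%:R else 0.
have a1 j : normc (expi (a j)) <= 1 by rewrite normc_expi.
pose w := mk_ell2 (square_summableZ a1 (ell2_summable z)).
have wr : torus r w by move=> j; rewrite /= normcM normc_expi mul1r zr.
(* The relation rewritten as a vanishing integer combination of the [lambda j]. *)
pose m j : int := if j == k then D%:Z else - n j.
(* A distance [e] in norm allows an error [e / r j] in the [j]-th phase factor, hence [C * e] in the
   combined one; the radius [(1 + C)^-1] keeps this below 1. *)
pose C : R := \sum_(j <- k :: s) `|m j|%:~R / r j.
have C0 : 0 <= C.
  by apply: sumr_ge0 => j _; rewrite divr_ge0 ?ler0z// ltW.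
have C1 : 0 < 1 + C by rewrite ltr_pwDl.
have e0 : 0 < (1 + C)^-1 by rewrite invr_gt0.
have [_ [[t _ <-]]] := dense w wr _ (nbhsx_ballx w _ e0).
rewrite -ball_normE /= => wt.
have near_angle j : normc (expi (lambda j * t - a j) - 1) <= (1 + C)^-1 / r j.
  rewrite ler_pdivlMr//; apply: le_trans (ltW wt).
  apply: le_trans (normc_le_l2norm j (ell2_summable (w - flow lambda t z))).
  rewrite -[(w - _) j]/(expi (a j) * z j - expi (lambda j * t) * z j).
  have -> : expi (lambda j * t) = expi (lambda j * t - a j) * expi (a j).
    by rewrite -expiD subrK.
  rewrite (_ : expi (a j) * z j - _ = - (expi (a j) * (expi (lambda j * t - a j) - 1) * z j)).
    by rewrite normcN !normcM normc_expi mul1r zr.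
  by ring.
(* Time cancels by [rel]; only the rotation of coordinate [k] survives, as [D] times [- pi / D]. *)
have phase : \sum_(j <- k :: s) (m j)%:~R * (lambda j * t - a j) = - pi.
  have D0' : D%:R != 0 :> R by rewrite pnatr_eq0 -lt0n.
  rewrite big_cons /m /a eqxx -pmulrn (eq_big_seq (fun j => - t * ((n j)%:~R * lambda j))).
    by rewrite -mulr_sumr -rel; field.
  move=> j js; have /negbTE-> : j != k by apply: contraNneq ks => <-.
  by rewrite mulrNz subr0; ring.
have := normc_expi_sum (k :: s) m (fun j => lambda j * t - a j).
have expi_pi : normc (expi pi - 1 : R[i]) = 2.
  rewrite /= cospi sinpi subr0 expr0n addr0 sqrtr_sqr.
  by rewrite -opprD normrN ger0_norm.
rewrite phase normc_expiN expi_pi leNgt => /negP; apply.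
apply: (@le_lt_trans _ _ (C / (1 + C))); last by rewrite ltr_pdivrMr//; lra.
rewrite {1}/C mulr_suml; apply: ler_sum => j _.
by rewrite -mulrA [_^-1 * _]mulrC ler_wpM2l ?ler0z.
Qed.

End DenseIncommensurable.

Theorem theorem3 (R : realType) (lambda r : nat -> R)
  (lambda_gt0 : forall k, 0 < lambda k)
  (r_gt0 : forall k, 0 < r k)
  (r_ell2 : cvgn (series (fun k => r k ^+ 2)))
  (z0 : ell2 R)
  (z0_torus : trajectory lambda z0 `<=` torus r) :
  torus r `<=` closure (trajectory lambda z0) <->
  ~ rationally_commensurable lambda.
Proof.
have z0r := trajectory_torus _ _ _ z0_torus.
split; first exact: dense_incommensurable.
exact: trajectory_dense.
Qed.
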